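(* Let $n\ge 1$ and let $\mathcal F$ be the set of all multilinear functions $f:\mathbb R^n\to\mathbb R$. Any attribution method on $\mathcal F$ which satisfies Additivity, Dummy', and Conditional Nonnegativity is a value-variant random order method.
   Context: A function $f:\mathbb R^n\to\mathbb R$ is multilinear if $f(x)=\sum_{I\subseteq\{1,\dots,n\}} c_I\prod_{i\in I}x_i$ for some real constants $c_I$. For $r,s\in\mathbb R^n$, $[r,s]$ denotes the closed box $I_1\times\cdots\times I_n$, where $I_i$ is the closed interval bounded by $r_i$ and $s_i$ (in either order; possibly a point). An attribution method on a class $\mathcal F$ of functions $\mathbb R^n\to\mathbb R$ assigns to every $r,s\in\mathbb R^n$ and $f\in\mathcal F$ real numbers $z_1(r,s,f),\dots,z_n(r,s,f)$ satisfying completeness: $\sum_{i=1}^n z_i(r,s,f)=f(s)-f(r)$. Axioms (required for all $r,s\in\mathbb R^n$, all functions in $\mathcal F$, and all indices $i$): Additivity: $z_i(r,s,f_1+f_2)=z_i(r,s,f_1)+z_i(r,s,f_2)$. Dummy': if $f$ does not depend on its $i$-th variable on $[r,s]$ (i.e. $f(x)=f(y)$ whenever $x,y\in[r,s]$ differ only in coordinate $i$), then $z_i(r,s,f)=0$. Conditional Nonnegativity: if $f$ is non-decreasing in its $i$-th variable on $[r,s]$ (i.e. $f(x)\le f(y)$ whenever $x,y\in[r,s]$ agree except possibly in coordinate $i$ and $x_i\le y_i$), then $s_i\ge r_i$ implies $z_i(r,s,f)\ge 0$, and $s_i\le r_i$ implies $z_i(r,s,f)\le 0$. Random orders: for $\sigma\in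 S_n$, let $z^\sigma_i(r,s,f)=f(u^{\{j:\sigma(j)\le\sigma(i)\}})-f(u^{\{j:\sigma(j)<\sigma(i)\}})$, where for $I\subseteq\{1,\dots,n\}$ the point $u^I\in\mathbb R^n$ has coordinates $u^I_j=s_j$ for $j\in I$ and $u^I_j=r_j$ for $j\notin I$. (This equals $\int\partial_i f\,dx_i$ along the path $\gamma^\sigma_{r,s}$ that walks from $r$ to $s$ along edges of the box $[r,s]$, changing variable $j$ from $r_j$ to $s_j$ at the $\sigma(j)$-th step.) An attribution method $z$ is a value-variant random order method if for every $r,s\in\mathbb R^n$ there are weights $w_\sigma(r,s)\ge0$ ($\sigma\in S_n$) with $\sum_\sigma w_\sigma(r,s)=1$, which may depend on $r$ and $s$ but not on $f$ or $i$, such that $z_i(r,s,f)=\sum_{\sigma\in S_n}w_\sigma(r,s)\,z_i^\sigma(r,s,f)$ for all $f\in\mathcal F$ and all $i$. *)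

(* Defs.v *)
(* Points of R^n are row vectors over an arbitrary realType. Coordinates and
   positions in an ordering are numbered from 0, which does not affect the
   comparisons of sigma j with sigma i below. *)
From HB Require Import structures.
From mathcomp Require Import all_boot all_order all_algebra all_fingroup.
From mathcomp Require Import boolp classical_sets reals.

Set Implicit Arguments.
Unset Strict Implicit.
Unset Printing Implicit Defensive.

Import Order.TTheory GRing.Theory Num.Theory.
Local Open Scope ring_scope.

Section Attribution.
Context {R : realType} {n : nat}.
Implicit Types (r s x y : 'rV[R]_n) (f : 'rV[R]_n -> R) (i j : 'I_n).
Implicit Types (F : set ('rV[R]_n -> R)).

Definition multilinear : set ('rV[R]_n -> R) := fun f =>
  exists c : {set 'I_n} -> R,
    forall x, f x = \sum_(I : {set 'I_n}) c I * \prod_(i in I) x 0 i.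

Definition box r s : set 'rV[R]_n := fun x =>
  forall i, Num.min (r 0 i) (s 0 i) <= x 0 i <= Num.max (r 0 i) (s 0 i).

Definition agree_off i x y : Prop := forall j, j != i -> x 0 j = y 0 j.

Definition independent_on r s i f : Prop :=
  forall x y, box r s x -> box r s y -> agree_off i x y -> f x = f y.

Definition nondecreasing_on r s i f : Prop :=
  forall x y, box r s x -> box r s y -> agree_off i x y ->
    x 0 i <= y 0 i -> f x <= f y.

(* An attribution method on a class F is a map on all functions of which only
   the values at members of F are constrained or used: every predicate below
   quantifies over F only. *)
Definition attribution : Type :=
  'rV[R]_n -> 'rV[R]_n -> ('rV[R]_n -> R) -> 'I_n -> R.

Implicit Types (z : attribution).

Definition attribution_method F z : Prop :=
  forall r s f, F f -> \sum_(i < n) z r s f i = f s - f r.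

Definition additivity F z : Prop :=
  forall r s f1 f2 i, F f1 -> F f2 -> F (f1 \+ f2) ->
    z r s (f1 \+ f2) i = z r s f1 i + z r s f2 i.

Definition dummy' F z : Prop :=
  forall r s f i, F f -> independent_on r s i f -> z r s f i = 0.

Definition conditional_nonnegativity F z : Prop :=
  forall r s f i, F f -> nondecreasing_on r s i f ->
    (r 0 i <= s 0 i -> 0 <= z r s f i) /\ (s 0 i <= r 0 i -> z r s f i <= 0).

Definition vertex r s (I : {set 'I_n}) : 'rV[R]_n :=
  \row_j (if j \in I then s 0 j else r 0 j).

Definition random_order (sigma : 'S_n) : attribution := fun r s f i =>
  f (vertex r s [set j | (sigma j <= sigma i)%N])
  - f (vertex r s [set j | (sigma j < sigma i)%N]).

Definition value_variant_random_order F z : Prop :=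
  attribution_method F z /\
  forall r s, exists w : 'S_n -> R,
    [/\ forall sigma, 0 <= w sigma,
        \sum_(sigma : 'S_n) w sigma = 1 &
        forall f i, F f ->
          z r s f i = \sum_(sigma : 'S_n) w sigma * random_order sigma r s f i].

End Attribution.

Arguments attribution R n : clear implicits.

(* Main.v *)
(* On the box, a multilinear function is the interpolation of its values at the
   vertices, so by Additivity, Dummy' and Conditional Nonnegativity the
   attribution of f to i is a nonnegative combination of the marginal
   contributions f (u^{S + i}) - f (u^S), with coefficients q_i(S) independent
   of f. Completeness says that q is a unit flow through the levels of the
   Boolean lattice; splitting it at each vertex proportionally to the outgoing
   flow gives a Markov chain on subsets, whose law on maximal chains is the
   required probability on orders. Coordinates with r_i = s_i carry no
   attribution: the flow stops at the set of the other coordinates, and the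
   chain is completed arbitrarily. *)
Require Import Defs.
From mathcomp Require Import all_boot all_order all_algebra all_fingroup.
From mathcomp Require Import boolp classical_sets reals.
From mathcomp Require Import finset ring lra.

Set Implicit Arguments.
Unset Strict Implicit.
Unset Printing Implicit Defensive.

Import Order.TTheory GRing.Theory Num.Theory.
Local Open Scope ring_scope.

(** * Decomposition of a unit flow on the Boolean lattice into orders *)

Section Flow.
Variable n : nat.
Implicit Types (sigma : 'S_n) (i j : 'I_n) (S T : {set 'I_n}).

Definition first_set sigma (k : nat) : {set 'I_n} := [set j | (sigma j < k)%N].

Lemma card_first_set sigma k : (k <= n)%N -> #|first_set sigma k| = k.
Proof.
move=> kn; have -> : first_set sigma k = sigma @^-1: [set j : 'I_n | (j < k)%N].
  by apply/setP => j; rewrite !inE.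
rewrite on_card_preimset; last by exists (sigma^-1)%g => j _; rewrite ?permK ?permKV.
have inj : injective (widen_ord kn) by move=> a b /(congr1 val) /= /val_inj.
rewrite -[RHS](card_ord k) -(card_imset predT inj).
apply: eq_card => j; rewrite !inE; apply/idP/imsetP => [jk | [a _ ->]].
  by exists (Ordinal jk) => //; apply: val_inj.
by rewrite /= ltn_ord.
Qed.

Lemma first_set_eq sigma i S :
  (first_set sigma (sigma i) == S)
  = (sigma i == #|S| :> nat) && (first_set sigma #|S| == S).
Proof.
apply/eqP/andP => [<-| [/eqP -> /eqP //]].
by rewrite card_first_set ?eqxx // ltnW.
Qed.

(** [q i S] is the flow from [S] to [i |: S]; it starts at the empty set and is free to stop at
    level [m]. *)
Variables (R : realFieldType) (m : nat) (q : 'I_n -> {set 'I_n} -> R).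
Hypothesis mn : (m <= n)%N.
Hypothesis q_ge0 : forall i S, 0 <= q i S.
Hypothesis q_in : forall i S, i \in S -> q i S = 0.
Hypothesis q_unit : (0 < m)%N -> \sum_i q i set0 = 1.
Hypothesis q_conserved : forall S, (0 < #|S| < m)%N ->
  \sum_i q i S = \sum_(i in S) q i (S :\ i).

(** Below level [k], the random order drawn from [w] follows each edge with the probability
    prescribed by [q]. *)
Definition transports (k : nat) (w : 'S_n -> R) : Prop :=
  [/\ forall sigma, 0 <= w sigma, \sum_sigma w sigma = 1 &
      forall i S, (#|S| < k)%N ->
        \sum_(sigma : 'S_n | first_set sigma (sigma i) == S) w sigma = q i S].

(** The weight reaching [T] is its inflow, known from the level below; conservation turns it into
    the outflow. *)
Lemma transports_first_set k w T : transports k w -> (k < m)%N -> #|T| = k ->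
  \sum_(sigma : 'S_n | first_set sigma k == T) w sigma = \sum_i q i T.
Proof.
move=> [w0 w1 wq] km cT.
case: k => [|k] in wq km cT *.
  rewrite (cards0_eq cT) q_unit // -w1; apply: eq_bigl => sigma.
  by apply/eqP/setP => j; rewrite !inE.
rewrite q_conserved ?cT //.
have kn : (k < n)%N by apply: leq_trans mn; apply: ltnW.
pose K := Ordinal kn.
(* Sort the orders by the last element to enter [T]. *)
rewrite (partition_big (fun sigma : 'S_n => (sigma^-1)%g K) (mem T)) /=; last first.
  by move=> sigma /eqP <-; rewrite inE permKV /=.
apply: eq_bigr => i iT; rewrite -wq; last first.
  by move: cT; rewrite (cardsD1 i) iT add1n => -[->].
have cTi : #|T :\ i| = k by move: cT; rewrite (cardsD1 i) iT add1n => -[->].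
apply: eq_bigl => sigma; rewrite first_set_eq cTi.
have -> : ((sigma^-1)%g K == i) = (sigma i == k :> nat).
  apply/eqP/eqP => [<-|e]; first by rewrite permKV.
  by apply: (@perm_inj _ sigma); rewrite permKV; apply: val_inj; rewrite /= e.
rewrite andbC; case: eqP => //= e.
apply/eqP/eqP => [<-|eT]; apply/setP => j.
  by rewrite !inE -e ltnS ltn_neqAle -(inj_eq (@perm_inj _ sigma) j i).
move/setP/(_ j): eT; rewrite !inE -e ltnS => eT; rewrite leq_eqVlt eT.
rewrite (inj_eq val_inj) (inj_eq (@perm_inj _ sigma)).
by case: eqP => [->|]; rewrite ?iT.
Qed.

(* Each sigma with first k elements S is redistributed over the permutations
   moving some i to position k, proportionally to q i S. *)
Lemma transportsS k w : transports k w -> (k < m)%N ->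
  exists w', transports k.+1 w'.
Proof.
move=> tw km; have marg T := transports_first_set (T := T) tw km.
case: tw => w0 w1 wq.
have kn : (k < n)%N by apply: leq_trans mn.
pose K := Ordinal kn.
pose M T := \sum_i q i T.
have M0 T : 0 <= M T by apply: sumr_ge0.
(* The transposition acts on positions and exchanges [i] with the element at position [k]. *)
pose move_to sigma i := (sigma * tperm K (sigma i))%g.
pose c sigma i := w sigma * (q i (first_set sigma k) / M (first_set sigma k)).
have c_sum sigma : \sum_i c sigma i = w sigma.
  rewrite -mulr_sumr -mulr_suml -/(M _).
  (* By [marg], this is the weight of all orders beginning with the same set; if it is 0, so is
     [w sigma]. *)
  have [M_0|Mn0] := eqVneq (M (first_set sigma k)) 0; last by rewrite divff ?mulr1.
  rewrite M_0 mul0r mulr0; apply/esym/eqP; rewrite eq_le w0 andbT.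
  rewrite -M_0 /M -marg ?card_first_set 1?ltnW //.
  by rewrite (bigD1 sigma) //= lerDl; apply: sumr_ge0.
have c_in sigma i : (sigma i < k)%N -> c sigma i = 0.
  by move=> ik; rewrite /c q_in ?mul0r ?mulr0 // inE.
pose w' tau := \sum_sigma \sum_(i | move_to sigma i == tau) c sigma i.
have sum_w' (P : pred 'S_n) : \sum_(tau | P tau) w' tau
    = \sum_sigma \sum_(i | P (move_to sigma i)) c sigma i.
  rewrite exchange_big; apply: eq_bigr => sigma _.
  rewrite (partition_big (move_to sigma) P) //=.
  apply: eq_bigr => tau Pt; apply: eq_bigl => i.
  by case: eqP => [->|]; rewrite ?Pt ?andbF.
(* For [i] outside the first [k] positions, the swap moves nothing across a threshold [a <= k]. *)
have lt_move sigma i j a : (k <= sigma i)%N -> (a <= k)%N ->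
    (move_to sigma i j < a)%N = (sigma j < a)%N.
  move=> ik ak; rewrite permM; case: tpermP => [->|->|//] /=.
    by rewrite !ltnNge (leq_trans ak ik) ak.
  by rewrite !ltnNge (leq_trans ak ik) ak.
have first_move sigma i a : (k <= sigma i)%N -> (a <= k)%N ->
    first_set (move_to sigma i) a = first_set sigma a.
  by move=> ik ak; apply/setP => j; rewrite !inE lt_move.
exists w'; split.
- move=> tau; apply: sumr_ge0 => sigma _; apply: sumr_ge0 => i _.
  by rewrite mulr_ge0 ?divr_ge0.
- by rewrite (sum_w' xpredT) -w1; apply: eq_bigr.
(* Edges below level [k] keep their weight; at level [k], an order uses the edge of [i] exactly when
   [i] is the element moved. *)
move=> i S; rewrite ltnS leq_eqVlt sum_w' => /orP[/eqP Sk|Sk]; last first.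
  rewrite -wq // [RHS]big_mkcond; apply: eq_bigr => sigma _.
  transitivity (\sum_(j | first_set sigma (sigma i) == S) c sigma j); last first.
    by case: eqP; rewrite ?c_sum // big_pred0.
  rewrite [LHS]big_mkcond [RHS]big_mkcond; apply: eq_bigr => j _.
  have [/c_in ->|kj] := ltnP (sigma j) k; first by rewrite !if_same.
  have Sk' := ltnW Sk; rewrite !first_set_eq first_move //.
  congr (if _ && _ then _ else _).
  by rewrite !eqn_leq !(leqNgt #|S|) -ltnS lt_move // -ltnS lt_move.
transitivity (\sum_(sigma : 'S_n | first_set sigma k == S) c sigma i).
  rewrite [RHS]big_mkcond; apply: eq_bigr => sigma _.
  transitivity (\sum_(j | (j == i) && (first_set sigma k == S)) c sigma j).
    rewrite [LHS]big_mkcond [RHS]big_mkcond; apply: eq_bigr => j _.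
    have [/c_in ->|kj] := ltnP (sigma j) k; first by rewrite !if_same.
    rewrite first_set_eq Sk first_move //; congr (if _ && _ then _ else _).
    (* Since [K] is the image of [sigma j] under the swap, injectivity reduces the equation to
       [j = i]. *)
    rewrite permM -[k]/(val K) val_eqE -{2}(tpermR K (sigma j)).
    by rewrite (inj_eq (@perm_inj _ _)) (inj_eq (@perm_inj _ _)) eq_sym.
  case: eqP => _; last by rewrite big_pred0 // => j; rewrite andbF.
  by rewrite (big_pred1 i) // => j; rewrite andbT.
under eq_bigr => sigma /eqP e do rewrite /c e.
rewrite -mulr_suml marg // -/(M S).
have [M_0|Mn0] := eqVneq (M S) 0; last by rewrite mulrCA divff ?mulr1.
rewrite M_0 mul0r; apply/esym/eqP; rewrite eq_le q_ge0 andbT -M_0.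
by rewrite /M (bigD1 i) //= lerDl; apply: sumr_ge0.
Qed.

Lemma flow_decomposition : exists w, transports m w.
Proof.
suff H k : (k <= m)%N -> exists w, transports k w by apply: H.
elim: k => [_|k IH km]; last first.
  by have [w tw] := IH (ltnW km); apply: transportsS tw km.
(* No set has fewer than 0 elements, so any probability starts the induction. *)
exists (fun sigma => (sigma == 1%g)%:R); split=> //.
by rewrite (bigD1 1%g) //= eqxx big1 ?addr0 // => sigma /negPf ->.
Qed.

End Flow.

(** * Additive maps of the real line *)

(* Such a map is monotone, so it is enough to compare it with integer multiples. *)
Lemma additive_ge0_linear (R : realType) (phi : R -> R) :
  {morph phi : a b / a + b} -> (forall a, 0 <= a -> 0 <= phi a) ->
  forall a, phi a = a * phi 1.
Proof.
move=> phiD phi_ge0 a.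
have phi0 : phi 0 = 0 by apply: (addrI (phi 0)); rewrite -phiD !addr0.
have phiN b : phi (- b) = - phi b.
  by apply: (addrI (phi b)); rewrite -phiD !subrr.
have phiMn b k : phi (b *+ k) = phi b *+ k.
  by elim: k => [|k IH]; rewrite ?mulr0n // !mulrSr phiD IH.
have phiMz k : phi k%:~R = phi 1 *~ k.
  by case: k => k; rewrite ?NegzE ?mulrNz ?phiN phiMn.
have mono b c : b <= c -> phi b <= phi c.
  by move=> bc; rewrite -subr_ge0 -phiN -phiD phi_ge0 // subr_ge0.
have phi1 : 0 <= phi 1 by apply: phi_ge0.
(* After multiplication by [N], both terms lie between the same two consecutive integer multiples of
   [phi 1]. *)
have close N : `|phi a - a * phi 1| *+ N <= phi 1.
  have /mono := Num.Theory.floor_le (a *+ N).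
  have /ltW/mono := Num.Theory.floorD1_gt (a *+ N).
  have := Num.Theory.floor_le (a *+ N).
  have /ltW := Num.Theory.floorD1_gt (a *+ N).
  rewrite !phiMz phiMn -normrMn mulrnBl -mulrnAl intrD mulrzDr mulr1z.
  rewrite -(mulrzr (phi 1)) -[phi 1 *~ 1]/(phi 1).
  move=> /(ler_wpM2r phi1) h1 /(ler_wpM2r phi1) h2 h3 h4.
  by rewrite ler_distl; apply/andP; split; lra.
apply/eqP; rewrite -subr_eq0 -normr_eq0; apply/negPn/negP => dn0.
have d_gt0 : 0 < `|phi a - a * phi 1| by rewrite lt_def dn0 /=.
have := close (Num.bound (phi 1 / `|phi a - a * phi 1|)).
apply/negP; rewrite -ltNge -mulr_natr mulrC -ltr_pdivrMr //.
by apply: archi_boundP; rewrite divr_ge0.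
Qed.

(** * Closure properties of multilinear functions *)

Section Multilinear.
Variables (R : realType) (n : nat).
Implicit Types (f g : 'rV[R]_n -> R).

Lemma multilinearD f g : multilinear f -> multilinear g -> multilinear (f \+ g).
Proof.
move=> [c fE] [d gE]; exists (fun I => c I + d I) => x /=.
by rewrite fE gE -big_split; apply: eq_bigr => I _; rewrite mulrDl.
Qed.

Lemma multilinearZ a f : multilinear f -> multilinear (fun x => a * f x).
Proof.
move=> [c fE]; exists (fun I => a * c I) => x.
by rewrite fE mulr_sumr; apply: eq_bigr => I _; rewrite mulrA.
Qed.

Lemma multilinear0 : multilinear (fun _ : 'rV[R]_n => 0).
Proof. by exists (fun=> 0) => x; rewrite big1 // => I _; rewrite mul0r. Qed.

(** Additivity is stated for [\+], so inductions on sums need this equality of functions. *)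
Lemma sum_consE (J : Type) (k : J) l (F : J -> 'rV[R]_n -> R) :
  (fun x => \sum_(m <- k :: l) F m x) = F k \+ (fun x => \sum_(m <- l) F m x).
Proof. by apply/funext => x; rewrite big_cons. Qed.

Lemma multilinear_sum (J : Type) (l : seq J) (F : J -> 'rV[R]_n -> R) :
  (forall j, multilinear (F j)) -> multilinear (fun x => \sum_(j <- l) F j x).
Proof.
move=> mF; elim: l => [|j l IH]; last by rewrite sum_consE; apply: multilinearD.
have -> : (fun x => \sum_(j <- [::]) F j x) = fun=> 0; last exact: multilinear0.
by apply/funext => x; rewrite big_nil.
Qed.

Lemma multilinear_prod_affine (a b : 'I_n -> R) :
  multilinear (fun x => \prod_i (a i * x 0 i + b i)).
Proof.
exists (fun I : {set 'I_n} => \prod_i (if i \in I then a i else b i)) => x.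
rewrite bigA_distr; apply: eq_bigr => I _.
rewrite [X in _ * X]big_mkcond -big_split; apply: eq_bigr => i _ /=.
by case: ifP => _; rewrite ?mulr1.
Qed.

Lemma multilinear_coord i : multilinear (fun x : 'rV[R]_n => x 0 i).
Proof.
exists (fun I : {set 'I_n} => (I == [set i])%:R) => x.
rewrite (bigD1 [set i]) //= eqxx mul1r big_set1 big1 ?addr0 // => I /negPf ->.
by rewrite mul0r.
Qed.

End Multilinear.

(** * Multilinear interpolation on a box *)

Section Box.
Variables (R : realType) (n : nat) (r s : 'rV[R]_n).
Implicit Types (x y : 'rV[R]_n) (i j : 'I_n) (S I : {set 'I_n}) (f : 'rV[R]_n -> R).

(* On a degenerate coordinate the division by 0 makes this 0. *)
Definition box_coord i x : R := (x 0 i - r 0 i) / (s 0 i - r 0 i).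

(** The interpolation basis: without degenerate coordinates, 1 at the vertex of [S] and 0 at every
    other vertex. *)
Definition box_indicator S x : R :=
  \prod_j (if j \in S then box_coord j x else 1 - box_coord j x).

Definition free_coords : {set 'I_n} := [set i | r 0 i != s 0 i].

Lemma multilinear_box_indicator S : multilinear (box_indicator S).
Proof.
pose d j := s 0 j - r 0 j.
have [c cE] := multilinear_prod_affine
  (fun j => if j \in S then (d j)^-1 else - (d j)^-1)
  (fun j => if j \in S then - r 0 j / d j else 1 + r 0 j / d j).
exists c => x; rewrite -cE; apply: eq_bigr => j _.
rewrite /box_coord -/(d j); by case: ifP => _; ring.
Qed.

Lemma box_coord_vertex i I :
  box_coord i (vertex r s I) = ((i \in I) && (i \in free_coords))%:R.
Proof.
rewrite /box_coord mxE inE; case: (i \in I) => /=; last by rewrite subrr mul0r.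
case: eqVneq => [->|rs]; first by rewrite subrr mul0r.
by rewrite divff // subr_eq0 eq_sym.
Qed.

Lemma box_indicator_vertex S I :
  box_indicator S (vertex r s I) = (I :&: free_coords == S)%:R.
Proof.
rewrite /box_indicator; under eq_bigr do rewrite box_coord_vertex.
case: eqP => [<-|/eqP neq].
  by rewrite big1 // => j _; rewrite inE; case: (_ && _); rewrite ?subr0.
have /existsP[j jP] : [exists j, (j \in I :&: free_coords) != (j \in S)].
  apply: contraNT neq => /existsPn eq; apply/eqP/setP => j.
  by apply/eqP/negPn/eq.
rewrite (bigD1 j) //=; move: jP; rewrite inE.
by case: (j \in S); case: (_ && _) => //= _; rewrite ?subrr mul0r.
Qed.

Lemma box_coordE i x : box r s x ->
  x 0 i = box_coord i x * s 0 i + (1 - box_coord i x) * r 0 i.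
Proof.
move=> /(_ i); rewrite /box_coord; case: (eqVneq (r 0 i) (s 0 i)) => [->|rs] xi.
  rewrite subrr invr0 mulr0 mul0r subr0 mul1r add0r.
  by apply/eqP; rewrite eq_le andbC; move: xi; rewrite minxx maxxx.
by field; rewrite subr_eq0 eq_sym.
Qed.

Lemma box_coord_itv i x : box r s x -> 0 <= box_coord i x <= 1.
Proof.
move=> /(_ i); rewrite /box_coord minElt maxElt.
case: (ltgtP (r 0 i) (s 0 i)) =>
  [/[dup] rs /ltW rs'|/[dup] rs /ltW rs'|->] /andP[a b].
- by rewrite divr_ge0 ?subr_ge0 //= ler_pdivrMr ?subr_gt0 // mul1r lerB.
- rewrite -mulrNN -invrN !opprB.
  by rewrite divr_ge0 ?subr_ge0 //= ler_pdivrMr ?subr_gt0 // mul1r lerB.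
- by rewrite subrr invr0 mulr0 lexx ler01.
Qed.

(** Each coordinate is a convex combination of its endpoints; expanding a monomial over the choices
    of endpoint yields its vertex values. *)
Lemma multilinear_interpolation f x : multilinear f -> box r s x ->
  f x = \sum_S f (vertex r s S) * box_indicator S x.
Proof.
move=> [c fE] xb; rewrite fE.
under [RHS]eq_bigr do rewrite fE mulr_suml.
rewrite exchange_big; apply: eq_bigr => I _ /=.
under [RHS]eq_bigr do rewrite -mulrA.
rewrite -mulr_sumr; congr (_ * _); rewrite big_mkcond /=.
(* Coordinates outside [I] enter as a combination of 1 and 1, so that the expansion runs over all
   [S]. *)
have xE j : (if j \in I then x 0 j else 1) =
    box_coord j x * (if j \in I then s 0 j else 1) +
    (1 - box_coord j x) * (if j \in I then r 0 j else 1).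
  by case: ifP => _; rewrite ?{1}(box_coordE j xb) // !mulr1 addrC subrK.
under eq_bigr do rewrite xE.
rewrite bigA_distr; apply: eq_bigr => S _.
rewrite [X in X * _]big_mkcond -big_split; apply: eq_bigr => j _ /=.
rewrite mxE mulrC.
by case: (j \in I); case: (j \in S); rewrite ?mulr1 ?mul1r // mulrC.
Qed.

Lemma box_indicator_degenerate S x : ~~ (S \subset free_coords) ->
  box_indicator S x = 0.
Proof.
case/subsetPn => j jS; rewrite inE negbK => /eqP rs.
by rewrite /box_indicator (bigD1 j) //= jS /box_coord rs subrr invr0 mulr0 mul0r.
Qed.

(** The two factors at [i] add up to 1, so coordinate [i] disappears. *)
Lemma box_indicator_setU1 S i x : i \notin S ->
  box_indicator (i |: S) x + box_indicator S x =
  \prod_(j | j != i) (if j \in S then box_coord j x else 1 - box_coord j x).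
Proof.
move=> iS; rewrite /box_indicator !(bigD1 (P := predT) i) //= setU11 (negPf iS).
rewrite (eq_bigr (fun j => if j \in S then box_coord j x else 1 - box_coord j x)).
  by rewrite -mulrDl addrC subrK mul1r.
by move=> j /negPf ji; rewrite !inE ji.
Qed.

Lemma box_coord_agree_off i x y j : agree_off i x y -> j != i ->
  box_coord j x = box_coord j y.
Proof. by rewrite /box_coord => xy /xy ->. Qed.

Lemma independent_on_setU1 S i : i \notin S ->
  independent_on r s i (box_indicator (i |: S) \+ box_indicator S).
Proof.
move=> iS x y _ _ xy /=; rewrite !box_indicator_setU1 //.
by apply: eq_bigr => j ji; rewrite !(box_coord_agree_off xy ji).
Qed.

(** Monotonicity is in [box_coord], whose direction against the coordinate itself depends on the
    sign of [s 0 i - r 0 i]. *)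
Lemma box_indicator_mono S i x y : i \in S ->
  box r s x -> box r s y -> agree_off i x y ->
  box_coord i x <= box_coord i y -> box_indicator S x <= box_indicator S y.
Proof.
move=> iS xb yb xy le; rewrite /box_indicator !(bigD1 (P := predT) i) //= iS.
rewrite (eq_bigr (fun j => if j \in S then box_coord j y else 1 - box_coord j y)).
  rewrite ler_wpM2r // prodr_ge0 // => j _.
  by have /andP[t0 t1] := box_coord_itv j yb; case: ifP; rewrite ?subr_ge0.
by move=> j ji; rewrite (box_coord_agree_off xy ji).
Qed.

Lemma independent_on_degenerate f i : i \notin free_coords ->
  independent_on r s i f.
Proof.
rewrite inE negbK => /eqP rs x y /(_ i) xb /(_ i) yb xy.
congr f; apply/rowP => j; have [->|/xy //] := eqVneq j i.
move: xb yb; rewrite rs minxx maxxx -!eq_le => xb yb.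
by apply/eqP; rewrite eq_le; lra.
Qed.

End Box.

(** * From the axioms to weights on orders *)

Section RandomOrder.
Variables (R : realType) (n : nat) (z : attribution R n).
Hypothesis z_complete : attribution_method multilinear z.
Hypothesis z_additive : additivity multilinear z.
Hypothesis z_dummy : dummy' multilinear z.
Hypothesis z_nonneg : conditional_nonnegativity multilinear z.
Variables (r s : 'rV[R]_n).
Implicit Types (x y : 'rV[R]_n) (i j : 'I_n) (S T : {set 'I_n}).
Implicit Types (f g : 'rV[R]_n -> R).

Let D := free_coords r s.
Let delta := box_indicator r s.

Let multilinear_delta S : multilinear (delta S).
Proof. exact: multilinear_box_indicator. Qed.
Hint Resolve multilinear_delta : core.
Hint Resolve multilinearZ : core.
Hint Resolve multilinearD : core.

(** The difference vanishes on the box, so Dummy' gives it attribution 0. *)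
Lemma attribution_eq_on_box f g i : multilinear f -> multilinear g ->
  (forall x, box r s x -> f x = g x) -> z r s f i = z r s g i.
Proof.
move=> mf mg fg.
have -> : f = g \+ (f \+ (fun x => -1 * g x)).
  by apply/funext => x /=; ring.
rewrite z_additive; [|by auto..].
rewrite (z_dummy (f := f \+ _)) ?addr0 //; first by auto.
by move=> x y xb yb _ /=; rewrite !fg // !mulN1r !subrr.
Qed.

Lemma attribution_sum (J : Type) (l : seq J) (F : J -> 'rV[R]_n -> R) i :
  (forall k, multilinear (F k)) ->
  z r s (fun x => \sum_(k <- l) F k x) i = \sum_(k <- l) z r s (F k) i.
Proof.
move=> mF; elim: l => [|k l IH].
  rewrite big_nil z_dummy //; first exact: multilinear_sum.
  by move=> x y _ _ _; rewrite !big_nil.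
have ml := multilinear_sum l mF.
by rewrite sum_consE big_cons z_additive ?IH //; apply: multilinearD.
Qed.

Lemma attribution_deltaD S a b i :
  z r s (fun x => (a + b) * delta S x) i =
  z r s (fun x => a * delta S x) i + z r s (fun x => b * delta S x) i.
Proof.
have -> : (fun x => (a + b) * delta S x)
    = (fun x => a * delta S x) \+ (fun x => b * delta S x).
  by apply/funext => x; rewrite mulrDl.
by rewrite z_additive; auto.
Qed.

Lemma attribution_delta_ge0 S i a : i \in S -> 0 <= a ->
  0 <= z r s (fun x => a * delta S x) i.
Proof.
move=> iS a0; have [rs|/ltW sr] := leP (r 0 i) (s 0 i).
  apply: (z_nonneg _ _).1 => //; first by auto.
  move=> x y xb yb xy le; rewrite ler_wpM2l // (box_indicator_mono iS xb yb xy) //.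
  by rewrite ler_wpM2r ?invr_ge0 ?subr_ge0 // lerB.
(* Here [box_coord] decreases in the coordinate, so the axiom is applied to the negated function. *)
have : z r s (fun x => - a * delta S x) i <= 0.
  apply: (z_nonneg _ _).2 => //; first by auto.
  move=> x y xb yb xy le; rewrite ler_wnM2l ?oppr_le0 //.
  rewrite (box_indicator_mono iS yb xb) //; first by move=> j /xy.
  by rewrite ler_wnM2r ?invr_le0 ?subr_le0 // lerB.
suff -> : z r s (fun x => a * delta S x) i = - z r s (fun x => - a * delta S x) i.
  by rewrite oppr_ge0.
apply/eqP; rewrite -addr_eq0 -attribution_deltaD; apply/eqP/z_dummy; first by auto.
by move=> x y _ _ _; rewrite subrr !mul0r.
Qed.

(** For [i] in [S], the left side is additive in [a] and preserves nonnegativity, hence is linear.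
    The other case follows since the indicators of [S] and [i |: S] have a sum independent of
    coordinate [i]. *)
Lemma attribution_deltaZ S i a :
  z r s (fun x => a * delta S x) i = a * z r s (delta S) i.
Proof.
have in_case T b : i \in T ->
    z r s (fun x => b * delta T x) i = b * z r s (delta T) i.
  move=> iT; rewrite (@additive_ge0_linear _ (fun b => z r s (fun x => b * delta T x) i)).
  - by congr (_ * z r s _ i); apply/funext => x; rewrite mul1r.
  - by move=> c d; apply: attribution_deltaD.
  - by move=> c; apply: attribution_delta_ge0.
have [/in_case //|iS] := boolP (i \in S).
have pair b : z r s (fun x => b * delta S x) i = - (b * z r s (delta (i |: S)) i).
  rewrite -in_case ?setU11 //; apply/eqP; rewrite -addr_eq0 addrC.
  rewrite -z_additive; [|by auto..]; apply/eqP/z_dummy; first by auto.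
  move=> x y xb yb xy /=; rewrite -!mulrDr.
  by have /= -> := independent_on_setU1 iS xb yb xy.
have -> : z r s (delta S) i = z r s (fun x => 1 * delta S x) i.
  by congr (z r s _ i); apply/funext => x; rewrite mul1r.
by rewrite !pair mul1r mulrN.
Qed.

(** The flow from [S] to [i |: S]; the value 0 for [i] in [S] lets sums run over all subsets. *)
Definition marginal i S : R := if i \in S then 0 else z r s (delta (i |: S)) i.

Lemma marginal_ge0 i S : 0 <= marginal i S.
Proof.
rewrite /marginal; case: ifP => // _.
by rewrite -[z r s _ i]mul1r -attribution_deltaZ attribution_delta_ge0 ?setU11.
Qed.

Lemma marginal_in i S : i \in S -> marginal i S = 0.
Proof. by rewrite /marginal => ->. Qed.

Lemma attribution_delta S i :
  z r s (delta S) i = if i \in S then marginal i (S :\ i) else - marginal i S.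
Proof.
rewrite /marginal setD11; case: ifPn => iS; first by rewrite setD1K.
rewrite (negPf iS); apply/eqP; rewrite -addr_eq0 addrC -z_additive; [|by auto..].
apply/eqP/z_dummy; first by auto.
exact: independent_on_setU1.
Qed.

(** Interpolate, then pair each [S] without [i] with [i |: S]: their indicators have opposite
    attributions to [i]. *)
Lemma attribution_marginal f i : multilinear f ->
  z r s f i =
  \sum_S marginal i S * (f (vertex r s (i |: S)) - f (vertex r s S)).
Proof.
move=> mf.
pose g x := \sum_S f (vertex r s S) * delta S x.
rewrite (@attribution_eq_on_box _ g) //; last 2 first.
- by apply: multilinear_sum => S; auto.
- by move=> x; apply: multilinear_interpolation.
rewrite attribution_sum; last by auto.
under eq_bigr do rewrite attribution_deltaZ attribution_delta.
rewrite (bigID (fun S => i \in S)) [RHS](bigID (fun S => i \in S)) /=.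
rewrite [X in _ = X + _]big1 ?add0r => [|S iS]; last by rewrite marginal_in ?mul0r.
under [RHS]eq_bigr do rewrite mulrBr.
rewrite [RHS]big_split /=; congr (_ + _); last first.
  by apply: eq_bigr => S /negPf ->; rewrite mulrN mulrC.
rewrite (reindex_onto (fun S => i |: S) (fun S => S :\ i)); last first.
  by move=> S; apply: setD1K.
rewrite [LHS](eq_bigl (fun S => i \notin S)); last first.
  move=> S /=; rewrite setU11 /=; apply/eqP/idP => [<-|]; last exact: setU1K.
  by rewrite setD11.
by apply: eq_bigr => S iS; rewrite setU11 setU1K // mulrC.
Qed.

(** This is completeness for the indicator of [S]: [r] and [s] are the vertices of the empty set and
    of [D]. *)
Lemma marginal_conserved S :
  \sum_(i in S) marginal i (S :\ i) - \sum_i marginal i S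
  = (D == S)%:R - (set0 == S)%:R.
Proof.
have /esym := @z_complete r s _ (multilinear_delta S).
have -> : delta S s = (D == S)%:R.
  rewrite -[D]setTI -box_indicator_vertex; congr delta.
  by apply/rowP => j; rewrite mxE inE.
have -> : delta S r = (set0 == S)%:R.
  rewrite -(set0I D) -box_indicator_vertex; congr delta.
  by apply/rowP => j; rewrite mxE inE.
move=> ->; rewrite big_mkcond -sumrB; apply: eq_bigr => i _.
by rewrite attribution_delta; case: ifP => iS; rewrite ?sub0r // (marginal_in iS) subr0.
Qed.

(** All of the coordinate function [x 0 i] is attributed to [i], and adding [i] to any set without
    it gains [s 0 i - r 0 i]. *)
Lemma sum_marginal i : i \in D -> \sum_S marginal i S = 1.
Proof.
rewrite inE => rs; pose f x : R := x 0 i.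
have mf : multilinear f by exact: multilinear_coord.
have d_neq0 : s 0 i - r 0 i != 0 by rewrite subr_eq0 eq_sym.
apply: (mulIf d_neq0); rewrite mul1r.
rewrite -[RHS](z_complete r s mf) [RHS](bigD1 i) //= [in RHS]big1 ?addr0 => [|j ji].
  rewrite attribution_marginal // mulr_suml; apply: eq_bigr => S _.
  have [iS|iS] := boolP (i \in S); first by rewrite marginal_in ?mul0r.
  by rewrite /f !mxE setU11 (negPf iS).
by apply: z_dummy => // x y _ _ xy; apply: xy; rewrite eq_sym.
Qed.

(** For [i] outside [S], the set [i |: S] exceeds [D] in size, so its indicator vanishes. *)
Lemma marginal_large i S : i \in D -> (#|D| <= #|S|)%N -> marginal i S = 0.
Proof.
move=> iD DS; rewrite /marginal; case: ifPn => // iS.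
have nD : ~~ (i |: S \subset D).
  by apply/negP => /subset_leq_card; rewrite cardsU1 iS add1n leqNgt ltnS DS.
by apply: z_dummy => // x y _ _ _; rewrite /delta !box_indicator_degenerate.
Qed.

Lemma random_order_weights : exists w : 'S_n -> R,
  [/\ forall sigma, 0 <= w sigma, \sum_(sigma : 'S_n) w sigma = 1 &
      forall f i, multilinear f ->
        z r s f i = \sum_(sigma : 'S_n) w sigma * random_order sigma r s f i].
Proof.
have Dn : (#|D| <= n)%N by rewrite -[X in (_ <= X)%N]card_ord max_card.
have unit : (0 < #|D|)%N -> \sum_i marginal i set0 = 1.
  rewrite card_gt0 => /negPf D0; have := marginal_conserved set0.
  by rewrite D0 eqxx big_set0 !sub0r => /oppr_inj.
have conserved S : (0 < #|S| < #|D|)%N ->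
    \sum_i marginal i S = \sum_(i in S) marginal i (S :\ i).
  move=> /andP[S0 SD]; apply/esym/eqP; rewrite -subr_eq0 marginal_conserved.
  rewrite [set0 == S]eq_sym -cards_eq0 -leqn0 leqNgt S0 subr0.
  by case: (D =P S) SD => [->|//]; rewrite ltnn.
have [w [w0 w1 wq]] :=
  flow_decomposition Dn marginal_ge0 marginal_in unit conserved.
exists w; split=> // f i mf.
(* At a degenerate coordinate both sides vanish. *)
have [iD|iD] := boolP (i \in D); last first.
  have eq_vertex S T : (forall j, j != i -> (j \in S) = (j \in T)) ->
      vertex r s S = vertex r s T.
    move: iD; rewrite inE negbK => /eqP rs ST; apply/rowP => j; rewrite !mxE.
    by have [->|/ST ->//] := eqVneq j i; rewrite rs !if_same.
  rewrite z_dummy //; last exact: independent_on_degenerate.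
  rewrite big1 // => sigma _; rewrite /random_order.
  rewrite (eq_vertex _ [set j | (sigma j < sigma i)%N]) ?subrr ?mulr0 // => j ji.
  by rewrite !inE leq_eqVlt (inj_eq val_inj) (inj_eq perm_inj) (negPf ji).
(* The probability that [S] is the set of predecessors of [i]; it has to match the flow at every
   level, not only below [#|D|]. *)
pose W S := \sum_(sigma : 'S_n | first_set sigma (sigma i) == S) w sigma.
have W0 S : 0 <= W S by apply: sumr_ge0.
have W1 : \sum_S W S = 1.
  by rewrite -w1 [RHS](partition_big
    (fun sigma : 'S_n => first_set sigma (sigma i)) predT).
(* [W] and the flow of [i] both have total 1 and agree below level [#|D|], where that flow is
   already exhausted. *)
have W_large S : (#|D| <= #|S|)%N -> W S = 0.
  pose large (T : {set 'I_n}) := (#|D| <= #|T|)%N.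
  move: S; suff /psumr_eq0P WS : \sum_(T | large T) W T = 0 by move=> S; apply: WS.
  have small_eq : \sum_(T | ~~ large T) W T = \sum_(T | ~~ large T) marginal i T.
    by apply: eq_bigr => T; rewrite -ltnNge; apply: wq.
  have large_eq0 : \sum_(T | large T) marginal i T = 0.
    by apply: big1 => T; apply: marginal_large.
  have := W1; rewrite -(sum_marginal iD) (bigID large) [RHS](bigID large) /=.
  by rewrite small_eq large_eq0 => /addIr.
have WE S : W S = marginal i S.
  have [SD|DS] := ltnP #|S| #|D|; first exact: wq.
  by rewrite W_large ?marginal_large.
rewrite attribution_marginal //.
rewrite [RHS](partition_big
  (fun sigma : 'S_n => first_set sigma (sigma i)) predT) //=.
apply: eq_bigr => S _; rewrite -WE mulr_suml; apply: eq_bigr => sigma /eqP <-.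
rewrite /random_order; congr (_ * (f (vertex _ _ _) - _)).
by apply/setP => j; rewrite !inE [(sigma j <= _)%N]leq_eqVlt
  (inj_eq val_inj) (inj_eq perm_inj).
Qed.

End RandomOrder.

Theorem theorem3p2 (R : realType) (n : nat) (n_ge1 : (1 <= n)%N)
    (z : attribution R n) :
  attribution_method multilinear z ->
  additivity multilinear z ->
  dummy' multilinear z ->
  conditional_nonnegativity multilinear z ->
  value_variant_random_order multilinear z.
Proof.
move=> zc za zd zn; split=> // r s.
exact: random_order_weights.
Qed.
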